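(* Let $x,y,z\in\mathcal{H}$, let $S=\{x,y,z\}$, and denote the cardinality of $S$ by $l$. Then exactly one of the following cases occurs: (i) $l=1$ and $CC(S)=x$. (ii) $l=2$, say $S=\{u,v\}$, where $u,v\in S$ and $u\ne v$, and $CC(S)=\frac{u+v}{2}$. (iii) $l=3$ and exactly one of the following two cases occurs: (a) $x,y,z$ are affinely independent; equivalently, $\|y-x\|\,\|z-x\|>|\langle y-x,z-x\rangle|$, and $$CC(S)=\frac{\|y-z\|^2\langle x-z,x-y\rangle x+\|x-z\|^2\langle y-z,y-x\rangle y+\|x-y\|^2\langle z-x,z-y\rangle z}{2\big(\|y-x\|^2\|z-x\|^2-\langle y-x,z-x\rangle^2\big)}.$$ (b) $x,y,z$ are affinely dependent; equivalently, $\|y-x\|\,\|z-x\|=|\langle y-x,z-x\rangle|$, and $CC(S)=\varnothing$.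
   Context: $\mathcal{H}$ is a real Hilbert space with inner product $\langle\cdot,\cdot\rangle$ and induced norm $\|\cdot\|$. $\operatorname{aff}(S)$ denotes the affine hull of $S$. Vectors $x,y,z$ are affinely independent if $\operatorname{aff}\{x,y,z\}$ has dimension $2$ (equivalently, $y-x,z-x$ are linearly independent), and affinely dependent otherwise. Circumcenter: for a nonempty finite set $S\subseteq\mathcal{H}$ there is at most one point $p\in\mathcal{H}$ such that $p\in\operatorname{aff}(S)$ and $\{\|p-s\|\mid s\in S\}$ is a singleton. $CC(S)$ is defined to be this point $p$ if it exists, and $CC(S)=\varnothing$ otherwise. *)

(* Defs.v *)
From HB Require Import structures.
From mathcomp Require Import all_boot all_order all_algebra finmap sesquilinear.
From mathcomp Require Import all_classical all_reals all_analysis.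

Set Implicit Arguments.
Unset Strict Implicit.
Unset Printing Implicit Defensive.

Import Order.TTheory GRing.Theory Num.Theory.
Import numFieldNormedType.Exports.

Local Open Scope classical_set_scope.
Local Open Scope ring_scope.

Definition exactly_one2 (P Q : Prop) : Prop :=
  (P /\ ~ Q) \/ (~ P /\ Q).

Definition exactly_one3 (P Q R : Prop) : Prop :=
  [\/ [/\ P, ~ Q & ~ R], [/\ ~ P, Q & ~ R] | [/\ ~ P, ~ Q & R]].

Section Affine.
Context {R : realType} {V : lmodType R}.

Definition affine_subspace (A : set V) : Prop :=
  A !=set0 /\ forall (t : R) (p q : V), A p -> A q -> A (t *: p + (1 - t) *: q).

Definition aff (S : set V) : set V := smallest affine_subspace S.

Definition linearly_independent (d : nat) (e : 'I_d -> V) : Prop :=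
  forall c : 'I_d -> R, \sum_(i < d) c i *: e i = 0 -> forall i, c i = 0.

(* A is a translate of a linear subspace having a basis of d vectors. *)
Definition has_affine_dim (A : set V) (d : nat) : Prop :=
  exists (p : V) (e : 'I_d -> V), linearly_independent e /\
    A = [set p + \sum_(i < d) c i *: e i | c in [set: 'I_d -> R]].

Definition affinely_independent3 (x y z : V) : Prop :=
  has_affine_dim (aff [set x; y; z]) 2.

Definition affinely_dependent3 (x y z : V) : Prop :=
  ~ affinely_independent3 x y z.

End Affine.

Section Circumcenter.
Context {R : realType} {V : normedModType R}.

Definition is_circumcenter (S : {fset V}) (p : V) : Prop :=
  aff [set` S] p /\ exists r : R, [set `|p - s| | s in [set` S]] = [set r].

(* None stands for the value "empty set". When the norm comes from an inner
   product, is_circumcenter S has at most one solution, so that the choice made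
   by cid is immaterial. *)
Definition CC (S : {fset V}) : option V :=
  if pselect (exists p, is_circumcenter S p) is left ex
  then Some (projT1 (cid ex)) else None.

End Circumcenter.

(* Main.v *)
Require Import Defs.
From HB Require Import structures.
From mathcomp Require Import all_boot all_order all_algebra finmap sesquilinear.
From mathcomp Require Import all_classical all_reals all_analysis.
From mathcomp Require Import ring lra.

Set Implicit Arguments.
Unset Strict Implicit.
Unset Printing Implicit Defensive.

Import Order.TTheory GRing.Theory Num.Theory.
Import numFieldNormedType.Exports.

Local Open Scope classical_set_scope.
Local Open Scope ring_scope.

(** Put u := y - x, v := z - x and write a candidate point as p = x + w.
    The theorem rests on two facts about the pair u, v.

    Affine hull.  The hull of x, y, z is x + span(u, v) ([aff3P]), so affine
    independence is linear independence of u and v, which is detected by the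
    Gram determinant g = |u|^2 |v|^2 - <u, v>^2: always g >= 0, and
    v <> 0 turns g = 0 into proportionality ([gram_mulr],
    [linearly_independent2P], [affinely_independent3P]).  Comparing g with 0 is
    the comparison of |u| |v| with |<u, v>|, which gives both equivalences.

    Equidistance.  Since |p - y|^2 = |w|^2 - 2 <w, u> + |u|^2, a circumcenter
    is a vector w of span(u, v) with 2 <w, u> = |u|^2 and 2 <w, v> = |v|^2
    ([is_circumcenter3P]).  This linear system decides every case:
    - repeated points are allowed in it, so w = 0 and w = u / 2 settle the sets
      {x, x, x} and {x, y, y}, that is, one or two points;
    - if g > 0, Cramer's rule yields the coefficients of w, and these are the
      barycentric coordinates of the announced point ([is_circumcenter3]);
    - if g = 0 and the points are distinct, u and v are proportional and the
      two equations force u = v ([collinear_no_circumcenter]).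

    A point found this way is the value of CC because two circumcenters of the
    same set differ by a vector orthogonal to the whole hull, hence to itself
    ([is_circumcenter_uniq]). *)

(** * The affine hull of three points *)

Section AffineHull.
Context {R : realType} {V : lmodType R}.
Implicit Types (x y z p u v : V) (S A : set V).

Lemma sum_scale2 (c : 'I_2 -> R) (e : 'I_2 -> V) :
  \sum_(i < 2) c i *: e i = c 0 *: e 0 + c 1 *: e 1.
Proof.
rewrite !big_ord_recl big_ord0 addr0.
by have -> : lift ord0 (ord0 : 'I_1) = 1 :> 'I_2 by apply: val_inj.
Qed.

(** The point x + a u + b v is the midpoint of x + 2a u and x + 2b v, which lie
    on the lines through x and x + u, and through x and x + v. *)
Lemma affine_subspace_comb2 A x u v (a b : R) : affine_subspace A ->
  A x -> A (x + u) -> A (x + v) -> A (x + (a *: u + b *: v)).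
Proof.
move=> [_ Aaff] Ax Au Av.
have line w c : A (x + w) -> A (x + c *: w).
  move=> Aw; have := Aaff c _ _ Aw Ax.
  by rewrite scalerDr scalerBl scale1r addrC addrA subrK.
have := Aaff 2^-1 _ _ (line u (2 * a) Au) (line v (2 * b) Av).
have -> : 1 - 2^-1 = 2^-1 :> R by field.
rewrite !scalerDr !scalerA addrACA -scalerDl.
have -> : 2^-1 + 2^-1 = 1 :> R by field.
by rewrite !mulKf ?pnatr_eq0 // scale1r.
Qed.

Lemma aff3P x y z p : aff [set x; y; z] p <->
  exists a b : R, p = x + (a *: (y - x) + b *: (z - x)).
Proof.
split=> [|[a [b ->]] A [Aaff xyzA]]; last first.
  apply: (affine_subspace_comb2 _ _ Aaff); rewrite ?subrKC; apply: xyzA.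
  - by left; left.
  - by left; right.
  - by right.
pose P := [set q | exists a b : R, q = x + (a *: (y - x) + b *: (z - x))].
apply: (smallest_sub (X := P)); last first.
  move=> q [[->|->]|->]; [exists 0, 0|exists 1, 0|exists 0, 1].
  - by rewrite !scale0r !addr0.
  - by rewrite scale0r scale1r addr0 addrC subrK.
  - by rewrite scale0r scale1r add0r addrC subrK.
split; first by exists x, 0, 0; rewrite !scale0r !addr0.
move=> t _ _ [a [b ->]] [c [d ->]].
exists (t * a + (1 - t) * c), (t * b + (1 - t) * d).
move: (y - x) (z - x) => u v.
rewrite !scalerDr !scalerA addrACA -scalerDl subrKC scale1r.
by rewrite addrACA -!scalerDl.
Qed.

(** Turns weights normalised by their sum into coordinates relative to the
    origin x, the form in which membership in the affine hull is expressed. *)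
Lemma barycentricE x y z (a b c d : R) : d != 0 -> a + b + c = d ->
  d^-1 *: (a *: x + b *: y + c *: z) =
  x + ((b / d) *: (y - x) + (c / d) *: (z - x)).
Proof.
move=> d0 abcd; rewrite -{1}(subrKC x y) -{1}(subrKC x z).
set u := y - x; set v := z - x; apply: (scalerI d0).
rewrite scalerA divff // scale1r !scalerDr !scalerA ![d * (_ / d)]mulrC !divfK //.
by rewrite [a *: x + _]addrA addrACA -!scalerDl abcd.
Qed.

End AffineHull.

(** * Inner products and the Gram determinant of two vectors *)

Section InnerProduct.
Context {R : realType} {V : normedModType R} (ip : {dot V for idfun}).
Implicit Types (x y z p u v w : V).

Lemma ipC u v : ip u v = ip v u.
Proof. by rewrite hermC expr0 mul1r. Qed.

Lemma ipDl u v w : ip (u + v) w = ip u w + ip v w.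
Proof. exact: linearDl. Qed.

Lemma ipNl u w : ip (- u) w = - ip u w.
Proof. exact: linearNl. Qed.

Lemma ipZl (a : R) u w : ip (a *: u) w = a * ip u w.
Proof. exact: linearZl_LR. Qed.

Lemma ipDr u v w : ip w (u + v) = ip w u + ip w v.
Proof. by rewrite ipC ipDl ![ip _ w]ipC. Qed.

Lemma ipNr u w : ip w (- u) = - ip w u.
Proof. by rewrite ipC ipNl ipC. Qed.

Lemma ipZr (a : R) u w : ip w (a *: u) = a * ip w u.
Proof. by rewrite ipC ipZl ipC. Qed.

Definition ipE := (ipDl, ipNl, ipZl, ipDr, ipNr, ipZr).

Lemma ip0l u : ip 0 u = 0. Proof. by rewrite -(scale0r 0) ipZl mul0r. Qed.

Lemma ip_gt0 u : u != 0 -> 0 < ip u u.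
Proof. exact: neq0_dnorm_gt0. Qed.

Lemma ip_ge0 u : 0 <= ip u u.
Proof. by have [->|/ip_gt0/ltW//] := eqVneq u 0; rewrite ip0l. Qed.

Lemma ip_eq0 u : ip u u = 0 -> u = 0.
Proof.
by move=> uu0; apply/eqP/negPn/negP => /ip_gt0; rewrite uu0 ltxx.
Qed.

Definition gram u v : R := ip u u * ip v v - ip u v ^+ 2.

(** The vector w is |v|^2 times the component of u orthogonal to v.  The
    identity is the source of the Cauchy-Schwarz inequality and of its equality
    case. *)
Lemma gram_mulr u v : let w := ip v v *: u - ip u v *: v in
  ip v v * gram u v = ip w w.
Proof. by rewrite /= /gram !ipE [ip v u]ipC; ring. Qed.

Lemma gram_ge0 u v : 0 <= gram u v.
Proof.
have [->|/ip_gt0 vv_gt0] := eqVneq v 0.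
  by rewrite /gram ip0l ipC ip0l mulr0 expr0n subrr.
by rewrite -(pmulr_rge0 _ vv_gt0) gram_mulr ip_ge0.
Qed.

Lemma gram_comb2 u v (a b c d : R) :
  gram (a *: u + b *: v) (c *: u + d *: v) = (a * d - b * c) ^+ 2 * gram u v.
Proof. by rewrite /gram !ipE [ip v u]ipC; ring. Qed.

Lemma gram_eq0_collinear u v :
  gram u v = 0 -> ip v v *: u = ip u v *: v.
Proof.
move=> g0; apply/eqP; rewrite -subr_eq0; apply/eqP/ip_eq0.
by rewrite -gram_mulr g0 mulr0.
Qed.

(** If the determinant vanishes, |v|^2 u - <u, v> v = 0 is a dependence relation,
    nontrivial unless v = 0, when 0 u + 1 v = 0 serves.  Conversely, pairing a
    dependence relation with both vectors gives a homogeneous system whose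
    determinant is the Gram determinant. *)
Lemma linearly_independent2P (e : 'I_2 -> V) :
  linearly_independent e <-> 0 < gram (e 0) (e 1).
Proof.
set u := e 0; set v := e 1; split=> [free_e|g_gt0 c].
  rewrite lt_neqAle gram_ge0 andbT eq_sym; apply/eqP => g0.
  pose c := fun i : 'I_2 => if i == 0 then ip v v else - ip u v.
  have c0 : \sum_(i < 2) c i *: e i = 0.
    by rewrite sum_scale2 /c /= scaleNr (gram_eq0_collinear g0) subrr.
  have /ip_eq0 v0 : ip v v = 0 by have := free_e c c0 0.
  have := free_e (fun i => (i == 1)%:R) _ 1.
  rewrite sum_scale2 /= -/u -/v v0 scaler0 scale0r addr0 => /(_ erefl)/eqP.
  by rewrite oner_eq0.
rewrite sum_scale2 -/u -/v => cuv0.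
have ipuv w : c 0 * ip u w + c 1 * ip v w = 0.
  by rewrite -!ipZl -ipDl cuv0 ip0l.
have g_neq0 : gram u v != 0 by rewrite gt_eqF.
(* Cramer elimination: the adjugate of the Gram matrix is applied to ipuv. *)
have c0 : c 0 * gram u v = 0.
  rewrite (_ : _ * _ = ip v v * (c 0 * ip u u + c 1 * ip v u) -
                        ip u v * (c 0 * ip u v + c 1 * ip v v)).
    by rewrite !ipuv !mulr0 subrr.
  by rewrite /gram [ip v u]ipC; ring.
have c1 : c 1 * gram u v = 0.
  rewrite (_ : _ * _ = ip u u * (c 0 * ip u v + c 1 * ip v v) -
                        ip u v * (c 0 * ip u u + c 1 * ip v u)).
    by rewrite !ipuv !mulr0 subrr.
  by rewrite /gram [ip v u]ipC; ring.
move=> i; have [->|i1] := eqVneq i 0.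
  by move/eqP: c0; rewrite mulf_eq0 (negPf g_neq0) orbF => /eqP.
have -> : i = 1 by case: i i1 => [[|[|]]] // ? _; apply: val_inj.
by move/eqP: c1; rewrite mulf_eq0 (negPf g_neq0) orbF => /eqP.
Qed.

(** If the hull has dimension 2, a basis e of its direction lies in the span of
    y - x and z - x, being made of differences of points of the hull; by
    [gram_comb2] its positive Gram determinant is a multiple of that of y - x
    and z - x. *)
Lemma affinely_independent3P x y z :
  affinely_independent3 x y z <-> 0 < gram (y - x) (z - x).
Proof.
set u := y - x; set v := z - x.
split=> [[p [e [/linearly_independent2P e_gt0 affE]]]|g_gt0].
  have hull i : exists a b : R, e i = a *: u + b *: v.
    have memhull q : aff [set x; y; z] q -> exists a b : R,
        q = x + (a *: u + b *: v) by move=> /aff3P.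
    have [a [b pE]] : exists a b : R, p = x + (a *: u + b *: v).
      apply: memhull; rewrite affE; exists (fun=> 0) => //.
      by rewrite sum_scale2 !scale0r !addr0.
    have [c [d peE]] : exists c d : R, p + e i = x + (c *: u + d *: v).
      apply: memhull; rewrite affE; exists (fun j => (j == i)%:R) => //.
      rewrite (bigD1 i) //= eqxx scale1r big1 ?addr0 // => j /negPf ->.
      by rewrite scale0r.
    exists (c - a), (d - b); apply: (addrI p); rewrite peE pE.
    by rewrite -addrA addrACA -!scalerDl !subrKC.
  have [a [b e0]] := hull 0; have [c [d e1]] := hull 1.
  have := gram_ge0 u v; rewrite le_eqVlt => /orP[/eqP g0|//].
  by move: e_gt0; rewrite e0 e1 gram_comb2 -g0 mulr0 ltxx.
pose e := fun i : 'I_2 => if i == 0 then u else v.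
exists x, e; split; first exact/linearly_independent2P.
apply/seteqP; split=> [p /aff3P[a [b ->]]|_ [c _ <-]].
  by exists (fun i => if i == 0 then a else b) => //; rewrite sum_scale2.
by apply/aff3P; exists (c 0), (c 1); rewrite sum_scale2.
Qed.

(** * Circumcenters *)

Context (norm_ip : forall u, `|u| = Num.sqrt (ip u u)).

Lemma sqr_norm_ip u : `|u| ^+ 2 = ip u u.
Proof. by rewrite norm_ip sqr_sqrtr ?ip_ge0. Qed.

Lemma gram_norm u v : gram u v = `|u| ^+ 2 * `|v| ^+ 2 - ip u v ^+ 2.
Proof. by rewrite !sqr_norm_ip. Qed.

Lemma gram_gt0 u v : (0 < gram u v) = (`|ip u v| < `|u| * `|v|).
Proof.
rewrite gram_norm subr_gt0 -exprMn -[_ ^+ 2 in LHS]real_normK ?num_real //.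
by rewrite ltr_pXn2r // nnegrE ?mulr_ge0.
Qed.

Lemma gram_eq0 u v : (gram u v == 0) = (`|u| * `|v| == `|ip u v|).
Proof.
rewrite gram_norm subr_eq0 -exprMn -[ip u v ^+ 2]real_normK ?num_real //.
by rewrite eqrXn2 // mulr_ge0.
Qed.

(** Expand |p - t|^2 with p - t = (p - s) - (t - s): equidistance becomes a
    condition linear in p. *)
Lemma equidistP p s t :
  `|p - s| = `|p - t| <-> 2 * ip (p - s) (t - s) = ip (t - s) (t - s).
Proof.
have E : `|p - t| ^+ 2 =
    `|p - s| ^+ 2 - (2 * ip (p - s) (t - s) - ip (t - s) (t - s)).
  have -> : p - t = (p - s) - (t - s) by rewrite opprB subrKA.
  rewrite !sqr_norm_ip !(ipDl (p - s)) !(ipDr (p - s)) !(ipNl, ipNr).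
  by rewrite [ip (t - s) (p - s)]ipC; ring.
split=> [st|st].
  by move: E; rewrite st => E; lra.
apply/eqP; rewrite -(@eqrXn2 _ 2) // E st subrr subr0 //.
Qed.

Lemma image_dist_eq (S : set V) p r s :
  [set `|p - s| | s in S] = [set r] -> S s -> `|p - s| = r.
Proof. by move=> rE Ss; have : [set r] `|p - s| by rewrite -rE; exists s. Qed.

(** By [equidistP] the pairing with p - q is constant on S, hence on its affine
    hull, which contains p and q: so p - q is orthogonal to itself. *)
Lemma is_circumcenter_uniq (S : {fset V}) p q :
  is_circumcenter S p -> is_circumcenter S q -> p = q.
Proof.
move=> [affp [r rE]] [affq [r' rE']].
have /=[s0 Ss0 _] : [set `|p - s| | s in [set` S]] r by rewrite rE.
have cst s : [set` S] s -> ip (p - q) s = ip (p - q) s0.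
  move=> Ss.
  have /equidistP Ep : `|p - s0| = `|p - s| by rewrite !(image_dist_eq rE).
  have /equidistP Eq : `|q - s0| = `|q - s| by rewrite !(image_dist_eq rE').
  by move: Ep Eq; rewrite !ipE; lra.
have hull t : aff [set` S] t -> ip (p - q) t = ip (p - q) s0.
  apply: (smallest_sub (X := [set t | ip (p - q) t = ip (p - q) s0])) => //.
  split; first by exists s0.
  by move=> c t1 t2 /= E1 E2; rewrite ipDr !ipZr E1 E2; ring.
apply/eqP; rewrite -subr_eq0; apply/eqP/ip_eq0.
by rewrite ipDr ipNr !hull // subrr.
Qed.

Lemma CC_Some (S : {fset V}) p : is_circumcenter S p -> CC S = Some p.
Proof.
move=> Sp; rewrite /CC; case: pselect => [ex|[]]; last by exists p.
by congr Some; apply: is_circumcenter_uniq Sp; exact: projT2 (cid ex).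
Qed.

Lemma CC_None (S : {fset V}) : (forall p, ~ is_circumcenter S p) -> CC S = None.
Proof.
by move=> Sn; rewrite /CC; case: pselect => // -[p Sp]; case: (Sn p).
Qed.

(** The points need not be distinct, which lets the same linear system treat
    sets of one, two and three points. *)
Lemma is_circumcenter3P x y z w :
  is_circumcenter [fset x; y; z]%fset (x + w) <->
  [/\ exists a b : R, w = a *: (y - x) + b *: (z - x),
      2 * ip w (y - x) = ip (y - x) (y - x)
    & 2 * ip w (z - x) = ip (z - x) (z - x)].
Proof.
have SE : [set` [fset x; y; z]%fset] = [set x; y; z].
  by rewrite !set_fsetU !set_fset1.
have xwx : x + w - x = w by rewrite addrAC subrr add0r.
rewrite /is_circumcenter SE; split=> [[/aff3P[a [b xwE]] [r rE]]|].
  have Hr := image_dist_eq rE.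
  split; first by exists a, b; exact: addrI xwE.
  - have /equidistP : `|x + w - x| = `|x + w - y|.
      by rewrite (Hr x) ?(Hr y) //; [left; right|left; left].
    by rewrite xwx.
  - have /equidistP : `|x + w - x| = `|x + w - z|.
      by rewrite (Hr x) ?(Hr z) //; [right|left; left].
    by rewrite xwx.
move=> [[a [b wE]] wy wz]; split; first by apply/aff3P; exists a, b; rewrite wE.
exists `|w|; apply/seteqP; split=> [_ [s Ss <-]|_ ->] /=; last first.
  by exists x; [left; left|rewrite xwx].
rewrite -{2}xwx; apply/esym/equidistP; rewrite xwx.
by case: Ss => [[->|->]|->] //; rewrite subrr [ip w 0]ipC !ip0l mulr0.
Qed.

Lemma is_circumcenter1 x : is_circumcenter [fset x]%fset x.
Proof.
suff : is_circumcenter [fset x; x; x]%fset (x + 0) by rewrite addr0 !fsetUid.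
apply/is_circumcenter3P; rewrite !subrr !ip0l mulr0; split=> //.
by exists 0, 0; rewrite !scale0r addr0.
Qed.

Lemma is_circumcenter2 u v : is_circumcenter [fset u; v]%fset (2^-1 *: (u + v)).
Proof.
have -> : 2^-1 *: (u + v) = u + 2^-1 *: (v - u).
  apply: (@scalerI _ _ 2); first by rewrite pnatr_eq0.
  rewrite [in RHS]scalerDr !scalerA divff ?pnatr_eq0 // !scale1r.
  by rewrite scaler_nat mulr2n -addrA subrKC.
suff : is_circumcenter [fset u; v; v]%fset (u + 2^-1 *: (v - u)).
  by rewrite -fsetUA fsetUid.
apply/is_circumcenter3P.
split; rewrite ?ipZl ?mulVKf ?pnatr_eq0 //.
by exists 2^-1, 0; rewrite scale0r addr0.
Qed.

(** The weights add up to twice the Gram determinant, so [barycentricE] exhibits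
    the solution given by Cramer's rule for the system of
    [is_circumcenter3P]. *)
Lemma is_circumcenter3 x y z : 0 < gram (y - x) (z - x) ->
  is_circumcenter [fset x; y; z]%fset
    ((2 * (`|y - x| ^+ 2 * `|z - x| ^+ 2 - ip (y - x) (z - x) ^+ 2))^-1 *:
       ((`|y - z| ^+ 2 * ip (x - z) (x - y)) *: x
        + (`|x - z| ^+ 2 * ip (y - z) (y - x)) *: y
        + (`|x - y| ^+ 2 * ip (z - x) (z - y)) *: z)).
Proof.
rewrite -gram_norm => g_gt0.
have g_neq0 : gram (y - x) (z - x) != 0 by rewrite gt_eqF.
rewrite barycentricE ?mulf_neq0 ?pnatr_eq0 //; last first.
  rewrite !sqr_norm_ip /gram !ipE.
  by rewrite [ip y x]ipC [ip z x]ipC [ip z y]ipC; ring.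
apply/is_circumcenter3P; split; first by eexists; eexists.
  rewrite [ip (_ *: _ + _ *: _) _]ipDl !ipZl; move: g_neq0; rewrite !sqr_norm_ip /gram !ipE.
  by rewrite [ip y x]ipC [ip z x]ipC [ip z y]ipC => g_neq0; field.
rewrite [ip (_ *: _ + _ *: _) _]ipDl !ipZl; move: g_neq0; rewrite !sqr_norm_ip /gram !ipE.
by rewrite [ip y x]ipC [ip z x]ipC [ip z y]ipC => g_neq0; field.
Qed.

(** With v proportional to u, the two equations on w say that its coordinate
    along the line is half that of u and half that of v; so u = v, against
    y <> z. *)
Lemma collinear_no_circumcenter x y z p : x != y -> y != z -> x != z ->
  gram (y - x) (z - x) = 0 -> ~ is_circumcenter [fset x; y; z]%fset p.
Proof.
move=> xy yz xz /gram_eq0_collinear; rewrite -(subrKC x p).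
set w := p - x; set u := y - x; set v := z - x => uv.
move=> /is_circumcenter3P[_]; rewrite -/u -/v => wu wv.
have uu : ip u u != 0 by rewrite gt_eqF // ip_gt0 // subr_eq0 eq_sym.
have vv : ip v v != 0 by rewrite gt_eqF // ip_gt0 // subr_eq0 eq_sym.
(* The two equations on w, combined along the relation uv. *)
have uuE : ip u u = ip u v.
  by apply: (mulfI vv); rewrite -wu mulrCA -ipZr uv ipZr mulrCA wv mulrC.
have vvE : ip v v = ip u v.
  by apply: (mulIf uu); rewrite -ipZr uv ipZr uuE.
case/eqP: yz; apply: (addIr (- x)); rewrite -/u -/v.
by apply: (scalerI vv); rewrite uv vvE.
Qed.

End InnerProduct.

(** * The trichotomy *)

Lemma card_fset3 (T : choiceType) (x y z : T) :
  let S := [fset x; y; z]%fset in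
  [\/ #|` S|%fset = 1%N /\ S = [fset x]%fset,
      #|` S|%fset = 2%N /\ (exists u v, u <> v /\ S = [fset u; v]%fset)
    | [/\ #|` S|%fset = 3%N, x != y, y != z & x != z]].
Proof.
move=> S; rewrite /S.
have [->|xy] := eqVneq x y; have [<-|yz] := eqVneq y z.
- by rewrite !fsetUid cardfs1; constructor 1.
- rewrite fsetUid cardfs2 yz; constructor 2; split=> //.
  by exists y, z; split=> //; apply/eqP.
- rewrite -fsetUA fsetUid cardfs2 xy; constructor 2; split=> //.
  by exists x, y; split=> //; apply/eqP.
have [<-|xz] := eqVneq x z.
  rewrite fsetUC fsetUA fsetUid cardfs2 xy; constructor 2; split=> //.
  by exists x, y; split=> //; apply/eqP.
constructor 3; split=> //.
rewrite fsetUC cardfsU1 cardfs2 xy !inE negb_or.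
by rewrite ![z == _]eq_sym xz yz.
Qed.

Theorem theorem8p4 (R : realType) (H : completeNormedModType R)
    (ip : {dot H for idfun})
    (norm_ip : forall u : H, `|u| = Num.sqrt (ip u u))
    (x y z : H) :
  let S : {fset H} := [fset x; y; z]%fset in
  let l : nat := #|` S|%fset in
  exactly_one3
    (l = 1%N /\ CC S = Some x)
    (l = 2%N /\
     exists u v : H, [/\ u \in S, v \in S, u <> v, S = [fset u; v]%fset
       & CC S = Some (2^-1 *: (u + v))])
    [/\ l = 3%N,
        affinely_independent3 x y z <->
          `|ip (y - x) (z - x)| < `|y - x| * `|z - x|,
        affinely_dependent3 x y z <->
          `|y - x| * `|z - x| = `|ip (y - x) (z - x)|
      & exactly_one2
          (affinely_independent3 x y z /\
           CC S = Some
             ((2 * (`|y - x| ^+ 2 * `|z - x| ^+ 2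
                    - ip (y - x) (z - x) ^+ 2))^-1 *:
              ((`|y - z| ^+ 2 * ip (x - z) (x - y)) *: x
               + (`|x - z| ^+ 2 * ip (y - z) (y - x)) *: y
               + (`|x - y| ^+ 2 * ip (z - x) (z - y)) *: z)))
          (affinely_dependent3 x y z /\ CC S = None)].
Proof.
move=> S l.
have indepP : affinely_independent3 x y z <->
    `|ip (y - x) (z - x)| < `|y - x| * `|z - x|.
  by rewrite -(gram_gt0 norm_ip); exact: affinely_independent3P.
have depP : affinely_dependent3 x y z <->
    `|y - x| * `|z - x| = `|ip (y - x) (z - x)|.
  rewrite (rwP eqP) -(gram_eq0 norm_ip) /affinely_dependent3.
  rewrite (affinely_independent3P ip) lt_neqAle gram_ge0 andbT eq_sym.
  by split=> [/negP/negPn//|/eqP ->]; rewrite eqxx.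
rewrite /l /S; case: (card_fset3 x y z) => /=.
- move=> [-> ->]; constructor 1; split; [split=> //|by case|by case].
  exact/(CC_Some norm_ip)/(is_circumcenter1 norm_ip).
- move=> [-> [u [v [uv ->]]]]; constructor 2; split; [by case| |by case].
  split=> //; exists u, v; split=> //; rewrite ?inE ?eqxx ?orbT //.
  exact/(CC_Some norm_ip)/(is_circumcenter2 norm_ip).
- move=> [-> xy yz xz]; constructor 3; split; [by case|by case|split=> //].
  have [indep|dep] := pselect (affinely_independent3 x y z); [left|right].
    split; last by case.
    split=> //; apply: (CC_Some norm_ip); apply: (is_circumcenter3 norm_ip).
    exact/affinely_independent3P.
  split; first by case.
  split=> //; apply: CC_None => p.
  apply: (collinear_no_circumcenter norm_ip) => //.
  by apply/eqP; rewrite (gram_eq0 norm_ip); apply/eqP/depP.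
Qed.
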